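(* Let $S$ be a semigroup with $0$ (not necessarily commutative). Then the undirected graph $\overline{\Gamma}(S)$ is connected and $\mathrm{diam}(\overline{\Gamma}(S))\le 3$.
   Context: $D(S)$ is the set of one-sided zero-divisors of $S$, and $D(S)^{*}=D(S)\setminus\{0\}$; thus a nonzero $a\in S$ lies in $D(S)^*$ iff there is a nonzero $b\in S$ with $ab=0$ or $ba=0$. $\overline{\Gamma}(S)$ is the undirected graph with vertex set $D(S)^{*}$ in which two distinct vertices $a,b$ are adjacent iff $ab=0$ or $ba=0$. $\mathrm{diam}$ is the supremum of the distances $d(x,y)$ (lengths of shortest paths; $d(x,x)=0$) over all vertices $x,y$. *)

(* Defs.v *)
From HB Require Import structures.
From mathcomp Require Import all_boot all_order all_algebra.
From mathcomp Require Import classical_sets reals ereal.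

Set Implicit Arguments.
Unset Strict Implicit.
Unset Printing Implicit Defensive.

Local Open Scope classical_set_scope.

(* Undirected simple graphs, possibly infinite, possibly without vertices. *)
Record sgraph : Type := SGraph {
  vertex :> choiceType;
  adj : rel vertex;
  adj_sym : symmetric adj;
  adj_irr : irreflexive adj }.

(* The vertex sequence of the path is x :: p, so its length is size p. *)
Definition is_path (G : sgraph) (x y : G) (p : seq G) : Prop :=
  [/\ path (@adj G) x p, last x p = y & uniq (x :: p)].

Definition connected_graph (G : sgraph) : Prop :=
  forall x y : G, exists p : seq G, is_path x y p.

Section Distance.
Variables (R : realType) (G : sgraph).
Local Open Scope ereal_scope.

(* This is +oo when no path joins x to y, since ereal_inf set0 = +oo. *)
Definition dist (x y : G) : \bar R :=
  ereal_inf [set ((size p)%:R)%:E | p in is_path x y].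

(* Distances live in [0, +oo], so the supremum of the empty set is taken to
   be 0; ereal_sup would give -oo. *)
Definition diam : \bar R :=
  supremum 0 [set dist xy.1 xy.2 | xy in [set: G * G]].

End Distance.

Section ZeroDivisorGraph.
Variables (S : semigroupType) (z : S).
Local Open Scope group_scope.

Definition is_zero : Prop := left_zero z *%g /\ right_zero z *%g.

Definition zero_divisors : set S :=
  [set a | exists2 b : S, b != z & a * b = z \/ b * a = z].

Definition nonzero_zero_divisors : set S := zero_divisors `\ z.

Definition zdg_adj : rel (set_type nonzero_zero_divisors) :=
  fun a b => (a != b) &&
    ((val a * val b == z) || (val b * val a == z)).

Lemma zdg_adj_sym : symmetric zdg_adj.
Proof. by move=> a b; rewrite /zdg_adj eq_sym orbC. Qed.

Lemma zdg_adj_irr : irreflexive zdg_adj.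
Proof. by move=> a; rewrite /zdg_adj eqxx. Qed.

Definition zero_divisor_graph : sgraph := SGraph zdg_adj_sym zdg_adj_irr.

End ZeroDivisorGraph.

(* Main.v *)
Require Import Defs.
From mathcomp Require Import all_boot all_order all_algebra.
From mathcomp Require Import classical_sets reals ereal.

(** Let [a] and [b] be vertices, [x] a nonzero element annihilating [a] on some
    side and [y] a nonzero element annihilating [b] on some side.  It suffices
    to find nonzero [c] and [d] such that each of the pairs (a, c), (c, d) and
    (d, b) is annihilating, where [c = d] is also allowed
    ([annihilating_chain]): then [c] and [d] are themselves vertices, and
    removing the repetitions and loops from the walk a, c, d, b leaves a path
    of length at most 3 ([path_of_lazy_walk]).

    The chain comes from one nonzero product that inherits annihilators from
    its factors.  If [a * x = 0] and [y * b = 0], then [x * y] is annihilated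
    by [a] on the left and by [b] on the right, so either it is zero and
    a, x, y, b is a walk, or it is a common neighbour of [a] and [b].  If
    [a * x = 0] and [b * y = 0], the product to consider is [x * b]: it is
    annihilated by [a] on the left and by [y] on the right, so either it is zero
    and [x] is a common neighbour, or a, x * b, y, b is a walk.  The two
    other cases are the mirror images of these. *)

Set Implicit Arguments.
Unset Strict Implicit.
Unset Printing Implicit Defensive.

Import Order.TTheory GRing.Theory Num.Theory.

(** The fallback value [x0] is taken when [A] is empty or has no supremum, hence
    the bound on [x0]. *)
Lemma supremum_le d (T : porderType d) (x0 m : T) (A : set T) :
  (x0 <= m)%O -> ubound A m -> (supremum x0 A <= m)%O.
Proof.
move=> x0m Am; rewrite /supremum; case: ifP => // _.
by case: xgetP => // y _ [_]; apply.
Qed.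

Section GraphWalks.
Variable G : sgraph.

Lemma path_of_walk (x : G) (p : seq G) :
  path (@adj G) x p ->
  exists2 q, is_path x (last x p) q & size q <= size p.
Proof.
move=> xp; case: (shortenP xp) => q xq uq sub_qp.
by exists q => //; apply: uniq_leq_size => //; case/andP: uq.
Qed.

(** Allowing a walk to stay in place spares the case analysis on which of the
    intermediate vertices of a chain coincide. *)
Lemma path_of_lazy_walk (x : G) (p : seq G) :
  path (fun u v => (u == v) || adj u v) x p ->
  exists2 q, is_path x (last x p) q & size q <= size p.
Proof.
move=> xp.
have [q xq [-> le_qp]] : exists2 q,
    path (@adj G) x q & last x p = last x q /\ size q <= size p.
  elim: p x xp => [|y p IHp] x /=; first by exists [::].
  case/andP=> /orP[/eqP<- | xy] /IHp[q xq [-> le_qp]].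
    by exists q => //; split=> //; apply: leqW.
  by exists (y :: q); rewrite /= ?xy.
by have [r xr le_rq] := path_of_walk xq; exists r => //; apply: leq_trans le_qp.
Qed.

Lemma dist_le_size (R : realType) (x y : G) (p : seq G) :
  is_path x y p -> (dist R x y <= ((size p)%:R)%:E)%E.
Proof. by move=> xyp; apply: ereal_inf_lbound; exists p. Qed.

Lemma diam_le (R : realType) (n : nat) :
  (forall x y : G, exists2 p, is_path x y p & size p <= n) ->
  (diam R G <= (n%:R)%:E)%E.
Proof.
move=> short; apply: supremum_le; first by rewrite lee_fin ler0n.
move=> _ [[x y] _ <-] /=; have [p xyp le_pn] := short x y.
by apply: le_trans (dist_le_size R xyp) _; rewrite lee_fin ler_nat.
Qed.

End GraphWalks.

Section Annihilation.
Variables (S : semigroupType) (z : S).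
Local Open Scope group_scope.

Definition annihilating (a b : S) : Prop := a * b = z \/ b * a = z.

Lemma annihilating_sym a b : annihilating a b -> annihilating b a.
Proof. by case; [right | left]. Qed.

(** A product inherits the left annihilators of its first factor and the right
    annihilators of its second, so each case tests the product whose
    two inherited annihilators lie on the chain.  The
    vanishing of that product is itself a link. *)
Lemma annihilating_chain (a b x y : S) (hz : is_zero z) :
  x != z -> y != z -> annihilating a x -> annihilating b y ->
  exists c d : S, [/\ c != z, d != z, annihilating a c, annihilating d b
                    & c = d \/ annihilating c d].
Proof.
case: hz => z_mul mul_z nzx nzy [ax | xa] [by0 | yb].
- have [xb | nzxb] := eqVneq (x * b) z.
    by exists x, x; split; rewrite /annihilating; auto.
  exists (x * b), y; split=> //; try by [left; rewrite mulgA ax z_mul | right].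
  by right; left; rewrite -mulgA by0 mul_z.
- have [xy | nzxy] := eqVneq (x * y) z.
    by exists x, y; split; rewrite /annihilating; auto.
  exists (x * y), (x * y); split=> //; last by left.
    by left; rewrite mulgA ax z_mul.
  by left; rewrite -mulgA yb mul_z.
- have [yx | nzyx] := eqVneq (y * x) z.
    by exists x, y; split; rewrite /annihilating; auto.
  exists (y * x), (y * x); split=> //; last by left.
    by right; rewrite -mulgA xa mul_z.
  by right; rewrite mulgA by0 z_mul.
- have [bx | nzbx] := eqVneq (b * x) z.
    by exists x, x; split; rewrite /annihilating; auto.
  exists (b * x), y; split=> //; try by [right; rewrite -mulgA xa mul_z | left].
  by right; right; rewrite mulgA yb z_mul.
Qed.

Lemma nonzero_zero_divisorsP (a : S) :
  nonzero_zero_divisors z a <->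
  a != z /\ exists2 b, b != z & annihilating a b.
Proof. by split=> [[aD /eqP az] | [/eqP az aD]]; split. Qed.

Lemma lazy_adj_annihilating (u v : zero_divisor_graph z) :
  val u = val v \/ annihilating (val u) (val v) -> (u == v) || adj u v.
Proof.
case=> [/val_inj-> | uv]; first by rewrite eqxx.
rewrite /= /zdg_adj; case: eqP => //= _.
by case: uv => ->; rewrite eqxx ?orbT.
Qed.

Lemma zero_divisor_graph_short_path (hz : is_zero z)
    (u v : zero_divisor_graph z) :
  exists2 p, is_path u v p & size p <= 3.
Proof.
have /nonzero_zero_divisorsP[nza [x nzx ax]] := set_mem (valP u).
have /nonzero_zero_divisorsP[nzb [y nzy yb]] := set_mem (valP v).
have [c [d [nzc nzd ac db cd]]] := annihilating_chain hz nzx nzy ax yb.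
have cD : nonzero_zero_divisors z c.
  by apply/nonzero_zero_divisorsP; split; last by
    exists (val u); last exact: annihilating_sym.
have dD : nonzero_zero_divisors z d.
  by apply/nonzero_zero_divisorsP; split; last by exists (val v).
pose c' : zero_divisor_graph z := SigSub (mem_set cD).
pose d' : zero_divisor_graph z := SigSub (mem_set dD).
apply: (@path_of_lazy_walk _ u [:: c'; d'; v]).
by apply/and4P; split=> //; apply: lazy_adj_annihilating; auto.
Qed.

End Annihilation.

Theorem theorem3p1 (R : realType) (S : semigroupType) (z : S) (hz : is_zero z) :
  connected_graph (zero_divisor_graph z) /\
  (diam R (zero_divisor_graph z) <= (3%:R)%:E)%E.
Proof.
split; last exact: diam_le (zero_divisor_graph_short_path hz).
by move=> u v; have [p uvp _] := zero_divisor_graph_short_path hz u v; exists p.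
Qed.
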